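(* Let $G$ be a finite non-cyclic nilpotent group which is not a $p$-group for any prime $p$. Then $\mathcal{F}(G)$ (for any choice of representatives in its construction) is a dominating set of $\mathcal{D}(G)$.
   Context: All groups are finite. The power graph $\mathcal{P}(G)$ is the simple graph with vertex set $G$ in which two distinct vertices are adjacent if one is a power of the other. The enhanced power graph $\mathcal{P}_E(G)$ is the simple graph with vertex set $G$ in which two distinct vertices $x,y$ are adjacent if $\langle x,y\rangle$ is cyclic. The difference graph $\mathcal{D}(G)$ is obtained from $\mathcal{P}_E(G)-\mathcal{P}(G)$ (vertex set $G$, edges those of $\mathcal{P}_E(G)$ that are not edges of $\mathcal{P}(G)$) by removing all isolated vertices. A dominating set of a graph $\Gamma$ is a set $D\subseteq V(\Gamma)$ such that every vertex is in $D$ or adjacent to some vertex of $D$. $\mathcal{M}(P)$ is the set of maximal cyclic subgroups of $P$ (cyclic subgroups not properly contained in another cyclic subgroup); $\exp(P)$ is the exponent of $P$. Construction for $p$-groups. Let $P$ be a non-cyclic $p$-group, $p$ prime. For $M,N\in\mathcal{M}(P)$ write $M\ll N$ if $p^2\le|M|\le|N|$ and $|M\cap N|=|M|/p$. If $\exp(P)>p$, let $\mathcal{S}'(P)$ be the set of all $C\in\mathcal{M}(P)$ with $|C|>p$ such that there is no $C'\in\mathcal{M}(P)$ with $|C'|>|C|$ and $C\ll C'$. On $\mathcal{S}'(P)$ let $C\equiv C'$ mean $C=C'$ or $C\ll C'$; this is an equivalence relation. Let $\mathcal{S}(P)$ be any system of representatives of the $\equiv$-classes, and let $\mathcal{F}(P)=\{x_1,\dots,x_k\}$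 consist of one chosen generator of each member of $\mathcal{S}(P)$, i.e. $\mathcal{S}(P)=\{\langle x_1\rangle,\dots,\langle x_k\rangle\}$ with $k=|\mathcal{S}(P)|$. If $\exp(P)=p$, let $\mathcal{F}(P)=\{x\}$ where $x$ is any chosen element of order $p$ of $P$. Construction for $G$. Let $G$ be non-cyclic nilpotent and not a $p$-group, and write $G=P_1\times\cdots\times P_t\times\mathbb{Z}_n$, where $P_1,\dots,P_t$ ($t\ge1$) are the non-cyclic Sylow subgroups of $G$, $P_i$ being the Sylow $p_i$-subgroup with $p_1,\dots,p_t$ pairwise distinct primes, and $\mathbb{Z}_n=\langle x\rangle$ is cyclic of order $n$ with $p_i\nmid n$ for all $i$ (possibly $n=1$, in which case $t\ge2$). Define $\mathcal{F}(G)=\bigcup_{i=1}^t\mathcal{F}(P_i)$ if $n=1$, and $\mathcal{F}(G)=\{x\}\cup\bigcup_{i=1}^t\mathcal{F}(P_i)$ if $n>1$. *)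

(* Defs.v *)
From mathcomp Require Import all_boot all_fingroup all_solvable.

Set Implicit Arguments.
Unset Strict Implicit.
Unset Printing Implicit Defensive.

Local Open Scope group_scope.

(* A simple graph whose vertices form a subset of a finite type.  The values of
   [adj] outside [verts] are irrelevant. *)
Record sgraph (T : finType) := SGraph {
  verts : {set T};
  adj : rel T;
  adj_sym : symmetric adj;
  adj_irrefl : irreflexive adj }.

Section Graphs.

Variable T : finType.
Implicit Types (A B : sgraph T) (D : {set T}).

Definition edge_diff_rel A B : rel T := fun x y => adj A x y && ~~ adj B x y.

Lemma edge_diff_sym A B : symmetric (edge_diff_rel A B).
Proof. by move=> x y; rewrite /edge_diff_rel !(adj_sym _ x). Qed.

Lemma edge_diff_irrefl A B : irreflexive (edge_diff_rel A B).
Proof. by move=> x; rewrite /edge_diff_rel adj_irrefl. Qed.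

Definition edge_diff A B : sgraph T :=
  SGraph (verts A) (@edge_diff_sym A B) (@edge_diff_irrefl A B).

Definition remove_isolated A : sgraph T :=
  SGraph [set x in verts A | [exists y in verts A, adj A x y]]
         (@adj_sym _ A) (@adj_irrefl _ A).

Definition dominating A D : bool :=
  (D \subset verts A)
  && [forall x in verts A, (x \in D) || [exists y in D, adj A x y]].

End Graphs.

Section PowerGraphs.

Variable gT : finGroupType.
Implicit Types (x y : gT) (G : {group gT}).

(* [x \in <[y]>] says that x is a power of y: see [cycleP]. *)
Definition power_rel : rel gT :=
  fun x y => (x != y) && ((x \in <[y]>) || (y \in <[x]>)).

Lemma power_rel_sym : symmetric power_rel.
Proof. by move=> x y; rewrite /power_rel eq_sym orbC. Qed.

Lemma power_rel_irrefl : irreflexive power_rel.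
Proof. by move=> x; rewrite /power_rel eqxx. Qed.

Definition enhanced_power_rel : rel gT :=
  fun x y => (x != y) && cyclic <<[set x; y]>>.

Lemma enhanced_power_rel_sym : symmetric enhanced_power_rel.
Proof. by move=> x y; rewrite /enhanced_power_rel eq_sym setUC. Qed.

Lemma enhanced_power_rel_irrefl : irreflexive enhanced_power_rel.
Proof. by move=> x; rewrite /enhanced_power_rel eqxx. Qed.

Definition power_graph G : sgraph gT :=
  SGraph G power_rel_sym power_rel_irrefl.

Definition enhanced_power_graph G : sgraph gT :=
  SGraph G enhanced_power_rel_sym enhanced_power_rel_irrefl.

Definition difference_graph G : sgraph gT :=
  remove_isolated (edge_diff (enhanced_power_graph G) (power_graph G)).

End PowerGraphs.

Section PGroup.

Variables (gT : finGroupType) (p : nat).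
Implicit Types (P C M N : {group gT}) (F : {set gT}).

Definition max_cyclic P : {set {group gT}} :=
  [set C : {group gT} | [max C | (C \subset P) && cyclic C]].

Definition ll M N : bool :=
  [&& p ^ 2 <= #|M|, #|M| <= #|N| & #|M :&: N| == #|M| %/ p]%N.

Definition S' P : {set {group gT}} :=
  [set C in max_cyclic P |
     (p < #|C|)%N && ~~ [exists C' in max_cyclic P, (#|C| < #|C'|)%N && ll C C']].

Definition equiv_ll : rel {group gT} := fun C C' => (C == C') || ll C C'.

Lemma equiv_ll_equiv P :
  prime p -> p.-group P -> {in S' P & &, equivalence_rel equiv_ll}.
Proof.
move=> p_pr pP.
have S'_max C : C \in S' P -> [/\ C \subset P, cyclic C &
    forall H : {group gT}, H \subset P -> cyclic H -> C \subset H -> H :=: C].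
  rewrite !inE => /andP[/maxgroupP[/andP[sCP cC] maxC] _]; split=> // H sHP cH.
  by apply: maxC; rewrite sHP.
have ll_card C C' : C \in S' P -> C' \in S' P -> ll C C' -> #|C| = #|C'|.
  rewrite inE => /and3P[_ _ /existsPn noC]; rewrite inE => /andP[mC' _] llC.
  apply/eqP; rewrite eqn_leq; case/and3P: (llC) => _ -> _ /=.
  by have:= noC C'; rewrite mC' llC andbT -leqNgt.
have ll_sym C C' : C \in S' P -> C' \in S' P -> ll C C' -> ll C' C.
  move=> SC SC' llC; have eqC := ll_card _ _ SC SC' llC.
  by move: llC; rewrite /ll eqC setIC.
have ll_trans C1 C2 C3 : C1 \in S' P -> C2 \in S' P -> C3 \in S' P ->
    ll C1 C2 -> ll C2 C3 -> equiv_ll C1 C3.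
  move=> S1 S2 S3 ll12 ll23; rewrite /equiv_ll.
  have [//|ne13] := eqVneq C1 C3.
  have e12 := ll_card _ _ S1 S2 ll12; have e23 := ll_card _ _ S2 S3 ll23.
  have [s1P cyc1 _] := S'_max _ S1; have [s2P cyc2 _] := S'_max _ S2.
  have [s3P cyc3 max3] := S'_max _ S3; have [_ _ max1] := S'_max _ S1.
  case/and3P: ll12 => le1 _ /eqP i12; case/and3P: ll23 => _ _ /eqP i23.
  apply/and3P; split=> //; first by rewrite e12 e23.
  have eqI : C1 :&: C2 = C2 :&: C3.
    apply/eqP; rewrite (eq_subG_cyclic cyc2) ?subsetIl ?subsetIr //.
    by rewrite i12 i23 e12.
  have s12 : C1 :&: C2 \subset C1 :&: C3.
    by rewrite subsetI subsetIl eqI subsetIr.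
  have p1 : p %| #|C1|.
    have [k eqk] := p_natP (pgroupS s1P pP).
    move: le1; rewrite eqk; case: k {eqk} => [|k] le1; last exact: dvdn_exp.
    by rewrite leqNgt (@ltn_exp2l p 0 2) ?prime_gt1 in le1.
  have p_gt0 := prime_gt0 p_pr.
  have idx : #|C1 : C1 :&: C2| = p.
    rewrite -divgS ?subsetIl // i12 -{1}(divnK p1) mulKn //.
    by rewrite divn_gt0 // dvdn_leq.
  have [|] := boolP (C1 \subset C3).
    move=> s13; case/eqP: ne13; apply: val_inj => /=; symmetry.
    exact: max1.
  move=> ns13; rewrite -i12 eq_sym.
  have: #|C1 : C1 :&: C3| != 1%N by rewrite indexg_eq1 subsetI subxx.
  have: #|C1 : C1 :&: C3| %| p by have := indexgS C1 s12; rewrite idx.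
  case/primeP: (p_pr) => _ /[apply] /orP[/eqP->//|/eqP e13 _].
  by rewrite -(eqn_pmul2r p_gt0) -{1}idx -e13 ![(#|_ :&: _| * _)%N]Lagrange ?subsetIl.
move=> C1 C2 C3 S1 S2 S3; split=> [|e12]; first by rewrite /equiv_ll eqxx.
have eq_sym' A B : A \in S' P -> B \in S' P -> equiv_ll A B -> equiv_ll B A.
  move=> SA SB /orP[/eqP->|llAB]; first by rewrite /equiv_ll eqxx.
  by rewrite /equiv_ll ll_sym ?orbT.
have eq_tr A B C : A \in S' P -> B \in S' P -> C \in S' P ->
    equiv_ll A B -> equiv_ll B C -> equiv_ll A C.
  move=> SA SB SC /orP[/eqP->//|llAB] /orP[/eqP<-|llBC].
    by rewrite /equiv_ll llAB orbT.
  exact: ll_trans llAB llBC.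
apply/idP/idP; last exact: eq_tr.
by apply: eq_tr => //; apply: eq_sym'.
Qed.

Definition repr_system P (S : {set {group gT}}) : bool :=
  is_transversal S (equivalence_partition equiv_ll (S' P)) (S' P).

(* F is one of the possible values of F(P), for P a non-cyclic p-group. *)
Definition is_F_pgroup P F : Prop :=
  ((p < exponent P)%N /\
     exists (S : {set {group gT}}) (gen : {group gT} -> gT),
       [/\ repr_system P S, {in S, forall C, generator C (gen C)}
         & F = [set gen C | C in S]])
  \/ (exponent P = p /\ exists x, [/\ x \in P, #[x] = p & F = [set x]]).

End PGroup.

Section Nilpotent.

Variable gT : finGroupType.
Implicit Types (G : {group gT}) (F : {set gT}) (x : gT).

Definition nilpotent_decomposition G t (p : 'I_t -> nat)
    (P : 'I_t -> {group gT}) x : Prop :=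
  [/\ (0 < t)%N, injective p,
      forall i, [/\ prime (p i), (p i).-Sylow(G) (P i), ~~ cyclic (P i)
                  & ~~ (p i %| #[x])%N]
    & (\big[dprod/1]_(i < t) P i) \x <[x]> = G].

(* F is one of the possible values of F(G). *)
Definition is_F G F : Prop :=
  exists t (p : 'I_t -> nat) (P : 'I_t -> {group gT}) x
         (FP : 'I_t -> {set gT}),
    [/\ nilpotent_decomposition G p P x,
        forall i, is_F_pgroup (p i) (P i) (FP i)
      & F = if #[x] == 1%N then \bigcup_(i < t) FP i
            else x |: \bigcup_(i < t) FP i].

End Nilpotent.

(* Main.v *)
(** Let [g] be a vertex and [h] a neighbour of [g].  As [h] is not a power of
    [g], some primary component [h_p] is not a power of [g]; as [<g, h>] is
    cyclic, [<g_p>] is then a proper subgroup of [<h_p>].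
    If the Sylow [p]-subgroup [P] is not cyclic, take a maximal cyclic subgroup
    of [P] of largest order among those properly containing [<g_p>].  Passing
    from [M] to [N] with [M << N] keeps all proper subgroups of [M], so this
    subgroup is in [S'(P)] and its representative in [S(P)] also properly
    contains [<g_p>].  The corresponding element of [F(P)] is adjacent to [g],
    as it is not a power of [g], and [g] is not a [p]-element: [g] is not a
    power of [h], so some [g_r] is not, and [r] differs from [p].
    If the Sylow [p]-subgroup is cyclic, [x] is not a power of [g]; so [x] is
    adjacent to [g], unless [g] is in [<x>], in which case [g] is adjacent to
    every element of every [F(P_i)]. *)
Require Import Defs.
From mathcomp Require Import all_boot all_fingroup all_solvable.

Set Implicit Arguments.
Unset Strict Implicit.
Unset Printing Implicit Defensive.

Local Open Scope group_scope.

(** * Primary components and adjacency in nilpotent groups *)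

Section Elements.

Variable gT : finGroupType.
Implicit Types (x y u v f g h : gT) (G H : {group gT}) (pi : nat_pred).

Lemma constt_notin x H : x \notin H -> exists p : nat, x.`_p \notin H.
Proof.
move=> nxH; have [/forallP xH | /forallPn[p nxp]] :=
  boolP [forall p : 'I_#[x].+1, x.`_(p : nat) \in H]; last by exists p.
by case/negP: nxH; rewrite -(prod_constt x) big_mkord group_prod.
Qed.

Lemma mem_cycle_constt pi f g : pi.-elt f -> f \in <[g]> -> f \in <[g.`_pi]>.
Proof.
move=> pif /cycleP[k eqf].
by rewrite -(constt_p_elt pif) eqf consttX mem_cycle.
Qed.

(** In the cyclic group [<[u]>] inclusion of subgroups is divisibility of orders, and two powers of
    [p] always divide one another in some direction. *)
Lemma p_elt_cycle_total (p : nat) x y u : p.-elt x -> p.-elt y ->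
  x \in <[u]> -> y \in <[u]> -> x \notin <[y]> -> y \in <[x]>.
Proof.
rewrite -!cycle_subG => px py xu yu.
rewrite -(cardSg_cyclic (cycle_cyclic u) xu yu).
rewrite -(cardSg_cyclic (cycle_cyclic u) yu xu) -!orderE.
have [a ->] := p_natP px; have [b ->] := p_natP py.
by case/orP: (leq_total a b) => le_ab; rewrite !(dvdn_exp2l _ le_ab).
Qed.

Lemma pi_elt_disjoint pi u v :
  pi.-elt u -> pi^'.-elt v -> v \in <[u]> -> v = 1.
Proof.
move=> piu pi'v vu; apply/eqP; rewrite -order_eq1; apply/eqP.
by apply: pnat_1 pi'v; rewrite -/(p_elt pi v) (mem_p_elt piu).
Qed.

Lemma nilpotent_commute pi G x y : nilpotent G -> x \in G -> y \in G ->
  pi.-elt x -> pi^'.-elt y -> commute x y.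
Proof.
move=> nilG xG yG pix piy; have /dprodP[_ _ cPQ _] := nilpotent_pcoreC pi nilG.
have mem rho z : z \in G -> rho.-elt z -> z \in 'O_rho(G).
  by move=> zG rhoz; rewrite (mem_normal_Hall (nilpotent_pcore_Hall _ nilG)) ?pcore_normal.
exact/esym/(centsP cPQ _ (mem _ _ yG piy) _ (mem _ _ xG pix)).
Qed.

(** By nilpotency [f] commutes with the [pi']-part of [g]. Their orders are coprime, so their
    product generates a cyclic group containing both, hence also [g]. *)
Lemma nilpotent_cyclic_gen pi G f g : nilpotent G -> f \in G -> g \in G ->
  pi.-elt f -> g.`_pi \in <[f]> -> cyclic <<[set g; f]>>.
Proof.
move=> nilG fG gG pif gf; have g'G : g.`_pi^' \in G by rewrite groupX.
have cfg := nilpotent_commute nilG fG g'G pif (p_elt_constt _ _).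
have co : coprime #[f] #[g.`_pi^'] := pnat_coprime pif (p_elt_constt _ _).
apply: cyclicS (cycle_cyclic (f * g.`_pi^')); rewrite gen_subG /= cycleM //.
apply/subsetP=> z /set2P[]->.
  by rewrite -{1}(consttC pi g) mem_mulg ?cycle_id.
by rewrite -[f in f \in _]mulg1 mem_mulg ?cycle_id.
Qed.

Lemma difference_adj G x y : cyclic <<[set x; y]>> ->
  x \notin <[y]> -> y \notin <[x]> -> adj (difference_graph G) x y.
Proof.
move=> cyc nxy nyx; have neq : x != y.
  by apply: contraNneq nxy => ->; apply: cycle_id.
by rewrite /= /edge_diff_rel /= /enhanced_power_rel /power_rel neq cyc (negPf nxy) (negPf nyx).
Qed.

Lemma difference_vert G x y : x \in G -> y \in G -> cyclic <<[set x; y]>> ->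
  x \notin <[y]> -> y \notin <[x]> -> x \in verts (difference_graph G).
Proof.
move=> xG yG cyc nxy nyx; rewrite inE /= xG; apply/existsP; exists y.
by rewrite yG; apply: (difference_adj G).
Qed.

Lemma difference_vertP G x : x \in verts (difference_graph G) ->
  x \in G /\ exists y, [/\ y \in G, cyclic <<[set x; y]>>,
                          x \notin <[y]> & y \notin <[x]>].
Proof.
rewrite inE /= => /andP[xG /existsP[y /and3P[yG /andP[neq cyc] npow]]].
move: npow; rewrite /= /power_rel neq negb_or => /andP[nxy nyx].
by split=> //; exists y.
Qed.

Lemma nilpotent_coprime_adj pi G x y : nilpotent G -> x \in G -> y \in G ->
    pi.-elt x -> pi^'.-elt y -> x != 1 -> y != 1 ->
  [/\ cyclic <<[set x; y]>>, x \notin <[y]> & y \notin <[x]>].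
Proof.
move=> nilG xG yG pix piy nx1 ny1; have pix' : pi^'^'.-elt x by rewrite p_eltNK.
split.
- apply: (nilpotent_cyclic_gen nilG yG xG piy).
  by rewrite (constt1P pix') group1.
- by apply: contra nx1 => xy; apply/eqP/(pi_elt_disjoint piy pix' xy).
- by apply: contra ny1 => yx; apply/eqP/(pi_elt_disjoint pix piy yx).
Qed.

End Elements.

(** * Maximal cyclic subgroups of a [p]-group *)

Section PGroupRepresentatives.

Variables (gT : finGroupType) (p : nat) (P : {group gT}).
Hypotheses (p_pr : prime p) (pP : p.-group P).
Implicit Types (C D : {group gT}) (F : {set gT}) (g h : gT).

Lemma max_cyclicP C : C \in max_cyclic P -> C \subset P /\ cyclic C.
Proof. by rewrite inE => /maxgroupp/andP. Qed.

(** The intersection of [C] and [D] has index [p] in the cyclic [p]-group [C], so it contains every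
    proper subgroup of [C]. *)
Lemma ll_mem C D g : C \in max_cyclic P -> ll p C D ->
  g \in C -> #[g] < #|C| -> g \in D.
Proof.
move=> /max_cyclicP[sCP cycC] /and3P[_ _ /eqP cardI] gC.
have [b eqb] := p_natP (pgroupS sCP pP).
have [a eqa] := p_natP (mem_p_elt pP (subsetP sCP g gC)).
rewrite eqa eqb ltn_exp2l ?prime_gt1 // => lt_ab.
suff: <[g]> \subset C :&: D by rewrite cycle_subG inE gC.
have sgC : <[g]> \subset C by rewrite cycle_subG.
rewrite -(cardSg_cyclic cycC sgC (subsetIl _ _)) cardI eqb -/(order g) eqa.
case: b lt_ab {eqb} => // b le_ab.
by rewrite expnS mulKn ?prime_gt0 // dvdn_exp2l.
Qed.

Lemma max_cyclic_above g h : p < exponent P -> h \in P -> g \in <[h]> ->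
  h \notin <[g]> ->
  exists C, [&& C \in max_cyclic P, p < #|C|, g \in C & #[g] < #|C|].
Proof.
move=> lt_p_exp hP gh nhg.
have [u [uP lt_pu gu lt_gu]] :
    exists u, [/\ u \in P, p < #[u], g \in <[u]> & #[g] < #[u]].
  (* If [g] is trivial, [h] may have order only [p], so an element of order [exponent P] is taken
     instead. Otherwise [u] is [h], as [p <= #[g] < #[h]]. *)
  have [->|ng1] := eqVneq g 1.
    have [u uP eq_exp] := exponent_witness (pgroup_nil pP).
    by exists u; rewrite group1 order1 -eq_exp lt_p_exp (ltn_trans (prime_gt1 p_pr)).
  have lt_gh : #[g] < #[h].
    by apply: proper_card; rewrite properE !cycle_subG gh.
  exists h; split=> //; apply: leq_ltn_trans lt_gh; apply: dvdn_leq => //.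
  have [[|a] eqa] := p_natP (mem_p_elt (mem_p_elt pP hP) gh); last by rewrite eqa dvdn_exp.
  by rewrite -order_eq1 eqa in ng1.
have: (<[u]> \subset P) && cyclic <[u]> by rewrite cycle_subG uP cycle_cyclic.
case/(@maxgroup_exists _ (fun C => (C \subset P) && cyclic C) <[u]>) => C maxC suC.
have le_uC := subset_leq_card suC.
exists C; rewrite inE maxC (leq_trans lt_pu) ?(subsetP suC) //.
exact: leq_trans lt_gu _.
Qed.

Lemma F_pgroup_cover F g h : is_F_pgroup p P F -> h \in P -> g \in <[h]> ->
  h \notin <[g]> -> exists f, [/\ f \in F, g \in <[f]> & f \notin <[g]>].
Proof.
move=> [[lt_p_exp [S [gen [trS genP ->]]]] | [expP [x [xP ox ->]]]] hP gh nhg; last first.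
  (* In exponent [p], the cycle of [h] has no nontrivial proper subgroup. *)
  have -> : g = 1.
    apply/eqP; apply: contraNT nhg => ng1.
    have oh : #[h] %| p by rewrite -expP dvdn_exponent.
    have lt_gh : #[g] %| #[h] by rewrite order_dvdG.
    suff -> : <[g]> = <[h]> by apply: cycle_id.
    apply/eqP; rewrite eqEcard cycle_subG gh dvdn_leq // -/(order g).
    have:= dvdn_trans lt_gh oh; case/primeP: (p_pr) => _ /[apply].
    by rewrite order_eq1 (negPf ng1) => /eqP->.
  exists x; rewrite set11 group1; split=> //; rewrite cycle1 inE -order_eq1 ox.
  by rewrite gtn_eqF ?prime_gt1.
have [C0 C0P] := max_cyclic_above lt_p_exp hP gh nhg.
pose Q C := [&& C \in max_cyclic P, p < #|C|, g \in C & #[g] < #|C|].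
case: (@arg_maxnP _ C0 Q (fun C : {group gT} => #|C|) C0P) => C /and4P[mC lt_pC gC lt_gC] maxC.
have SC : C \in S' p P.
  (* A larger [D] with [ll p C D] would satisfy [Q] too, against the choice of [C]. *)
  rewrite inE mC lt_pC; apply/existsP=> -[D /and3P[mD ltCD llCD]].
  suff /maxC : Q D by rewrite /= leqNgt ltCD.
  by rewrite /Q mD (ltn_trans lt_pC) ?(ltn_trans lt_gC) ?(ll_mem mC llCD).
have [D DS eqCD] : exists2 D, D \in S & equiv_ll p C D.
  have eqR := equiv_ll_equiv p_pr pP.
  have partS := equivalence_partitionP eqR.
  case/and3P: trS => _ sSS' /forall_inP trS.
  have /trS/cards1P[D eqD] :
      pblock (equivalence_partition (equiv_ll p) (S' p P)) C
        \in equivalence_partition (equiv_ll p) (S' p P).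
    by rewrite pblock_mem // (cover_partition partS).
  have /setIP[DS DB] : D \in S :&: pblock (equivalence_partition (equiv_ll p) (S' p P)) C.
    by rewrite eqD set11.
  exists D => //; rewrite -(pblock_equivalence_partition eqR) //.
  exact: subsetP DS.
have [gD lt_gD] : g \in D /\ #[g] < #|D|.
  case/orP: eqCD => [/eqP<-|llCD] //; split; first exact: ll_mem llCD gC lt_gC.
  by case/and3P: llCD => _ leCD _; apply: leq_trans leCD.
have /eqP eqD := genP D DS.
exists (gen D); rewrite imset_f -?eqD //; split=> //.
apply: contraL lt_gD; rewrite -cycle_subG -eqD -leqNgt; exact: subset_leq_card.
Qed.

Lemma F_pgroup_mem F f : is_F_pgroup p P F -> f \in F -> f \in P /\ f != 1.
Proof.
case=> [[_ [S [gen [/and3P[_ sSS' _] genP ->]]]] | [_ [x [xP ox ->]]]]; last first.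
  by move/set1P->; rewrite -order_eq1 ox gtn_eqF ?prime_gt1.
case/imsetP=> C CS ->; have /eqP eqC := genP C CS.
have := subsetP sSS' C CS; rewrite inE => /and3P[/max_cyclicP[sCP _] lt_pC _].
rewrite -cycle_subG -eqC sCP -order_eq1 orderE -eqC.
by rewrite gtn_eqF // (ltn_trans (prime_gt1 p_pr)).
Qed.

End PGroupRepresentatives.

(** The index of [<[x]>] is the product of the orders of the [P i]. Being normal and Hall, [<[x]>]
    contains exactly the elements of [G] whose order involves none of the [p i]. *)
Lemma nilpotent_decomposition_Hall (gT : finGroupType) (G : {group gT}) t
    (p : 'I_t -> nat) (P : 'I_t -> {group gT}) x :
    nilpotent_decomposition G p P x ->
  [pred q | [forall i, q != p i]].-Hall(G) <[x]> /\ <[x]> <| G.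
Proof.
move=> [_ _ sylP defG]; have nsxG : <[x]> <| G by case/dprod_normal2: defG.
split=> //; set pi := [pred q | _].
rewrite /pHall normal_sub //=; apply/andP; split.
  apply/pgroupP=> q q_pr q_x; apply/forallP=> i.
  by apply: contraTneq q_x => ->; case: (sylP i).
case/dprodP: (defG) => [[Q _ defQ _] _ _ _].
rewrite -(divgS (normal_sub nsxG)) -(dprod_card defG) mulnK ?order_gt0 //.
rewrite defQ -(bigdprod_card defQ).
apply: (big_ind (fun n => pnat _ n)) => // [m n pm pn|i _]; first by rewrite pnatM pm.
case: (sylP i) => p_pr /pHall_pgroup pP _ _.
apply: sub_pgroup pP => q; rewrite !inE => /eqP->.
by apply/forallPn; exists i; rewrite eqxx.
Qed.

Theorem lemma5p3 (gT : finGroupType) (G : {group gT}) (F : {set gT}) :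
  ~~ cyclic G -> nilpotent G -> (forall p : nat, prime p -> ~~ (p.-group G)%g) ->
  is_F G F -> dominating (difference_graph G) F.
Proof.
move=> _ nilG notpG [t [p [P [x [FP [decG FPP defF]]]]]].
have [hallX nsxG] := nilpotent_decomposition_Hall decG.
set pi := [pred q | _] in hallX.
have [t_gt0 _ sylP _] := decG.
have xG : x \in G by rewrite -cycle_subG normal_sub.
have pix : pi.-elt x := pHall_pgroup hallX.
have FP_mem i f : f \in FP i -> [/\ f \in G, (p i).-elt f & f != 1].
  move=> fF; case: (sylP i) => p_pr sPi _ _.
  have [fP nf1] := F_pgroup_mem p_pr (FPP i) fF.
  by rewrite (subsetP (pHall_sub sPi)) ?(mem_p_elt (pHall_pgroup sPi)).
have FPF i f : f \in FP i -> f \in F.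
  move=> fi; have fU : f \in \bigcup_(j < t) FP j by apply/bigcupP; exists i.
  by rewrite defF; case: ifP => // _; rewrite inE fU orbT.
have [f0 f0F [f0G pi'f0 nf0]] :
    exists2 f, f \in F & [/\ f \in G, pi^'.-elt f & f != 1].
  pose i := Ordinal t_gt0; case: (sylP i) => p_pr sPi ncPi _.
  have /trivgPn[h hP nh1] : P i :!=: 1.
    by apply: contraNneq ncPi => ->; apply: cyclic1.
  (* Covering the identity only serves to show that [FP i] is not empty. *)
  have [|f [fF _ _]] := F_pgroup_cover p_pr (pHall_pgroup sPi) (FPP i) hP (group1 _).
    by rewrite cycle1 inE.
  have [fG pf nf1] := FP_mem _ _ fF; exists f; first exact: FPF fF.
  split=> //; apply: sub_p_elt pf => q; rewrite !inE => /eqP->.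
  by apply/forallPn; exists i; rewrite eqxx.
rewrite /dominating; apply/andP; split.
  apply/subsetP=> f; rewrite defF => fF.
  have [/bigcupP[i _ fi] | [-> nx1]] :
      f \in \bigcup_(j < t) FP j \/ f = x /\ x != 1.
    move: fF; rewrite order_eq1; have [_ | nx1] := eqVneq x 1; first by left.
    by case/setU1P; [right | left].
    have [fG pf nf1] := FP_mem _ _ fi; case: (sylP i) => p_pr _ _ _.
    (* By Cauchy, if all these components were trivial, [p i] would be the only prime dividing the
       order of [G]. *)
    have [y yG ny] : exists2 y, y \in G & y.`_(p i)^' != 1.
      apply/exists_inP; apply: contraR (notpG _ p_pr) => /exists_inPn no_y.
      apply/pgroupP=> q q_pr /(Cauchy q_pr)[y yG oy].
      have := no_y y yG; rewrite negbK => /eqP/constt1P.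
      by rewrite p_eltNK /p_elt oy pnatE.
    have y'G : y.`_(p i)^' \in G by rewrite groupX.
    have [cyc n1 n2] := nilpotent_coprime_adj nilG fG y'G pf (p_elt_constt _ _) nf1 ny.
    exact: difference_vert fG y'G cyc n1 n2.
  have [cyc n1 n2] := nilpotent_coprime_adj nilG xG f0G pix pi'f0 nx1 nf0.
  exact: difference_vert xG f0G cyc n1 n2.
apply/forall_inP=> g /difference_vertP[gG [h [hG cyc_gh ngh nhg]]].
(* Every vertex, even one in [F], is shown to have a neighbour in [F]. *)
apply/orP; right.
suff [f fF [cyc ngf nfg]] : exists2 f, f \in F &
    [/\ cyclic <<[set g; f]>>, g \notin <[f]> & f \notin <[g]>].
  by apply/exists_inP; exists f => //; apply: difference_adj.
have [u gen_u] := cyclicP cyc_gh.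
have gu : g \in <[u]> by rewrite -gen_u mem_gen // !inE eqxx.
have hu : h \in <[u]> by rewrite -gen_u mem_gen // !inE eqxx orbT.
have [q nhq] := constt_notin nhg; have [r ngr] := constt_notin ngh.
have sgq : <[g.`_q]> \subset <[g]> by rewrite cycle_subG groupX ?cycle_id.
have shq : <[h.`_q]> \subset <[h]> by rewrite cycle_subG groupX ?cycle_id.
have nhgq : h.`_q \notin <[g.`_q]>.
  by apply: contra nhq; apply: (subsetP sgq).
have ghq : g.`_q \in <[h.`_q]>.
  by apply: (@p_elt_cycle_total _ q _ _ u) nhgq; rewrite ?p_elt_constt ?groupX.
(* The [q]-part of [g] is a power of [h], while the [r]-part is not. *)
have neq_qr : r != q.
  by apply: contraNneq ngr => ->; apply: (subsetP shq).
have ng1 : g.`_r != 1 by apply: contraNneq ngr => ->; apply: group1.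
have [piq | /forallPn[i /negPn/eqP eqi]] := boolP (q \in pi).
  have hqx : h.`_q \in <[x]>.
    rewrite (mem_normal_Hall hallX) ?groupX //.
    by apply: sub_p_elt (p_elt_constt q h) => s; rewrite inE => /eqP->.
  have nxg : x \notin <[g]>.
    by rewrite -cycle_subG; apply: contra nhq => sxg; apply: (subsetP sxg).
  have [gx | ngx] := boolP (g \in <[x]>).
    exists f0 => //; apply: (nilpotent_coprime_adj nilG gG f0G) pi'f0 _ nf0.
      exact: mem_p_elt pix gx.
    by apply: contraNneq ng1 => ->; rewrite constt1.
  exists x.
    rewrite defF order_eq1 ifN ?setU11 //.
    by apply: contraNneq nxg => ->; apply: group1.
  split=> //; apply: (nilpotent_cyclic_gen nilG xG gG pix).
  by rewrite (mem_normal_Hall hallX) ?groupX ?p_elt_constt.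
case: (sylP i) => p_pr sPi _ _.
have nsPi : P i <| G.
  by rewrite (nilpotent_Hall_pcore nilG sPi) pcore_normal.
have hqP : h.`_q \in P i.
  by rewrite (mem_normal_Hall sPi) ?groupX // eqi p_elt_constt.
have [f [fF gf nfg]] := F_pgroup_cover p_pr (pHall_pgroup sPi) (FPP i) hqP ghq nhgq.
have [fG pf _] := FP_mem _ _ fF; rewrite -eqi in pf.
exists f; first exact: FPF fF.
split; first exact: nilpotent_cyclic_gen nilG fG gG pf gf.
  (* Were [g] a power of the [q]-element [f], its [r]-part would be both a [q]-element and a
     [q']-element. *)
  apply: contra ng1 => gf'; apply/eqP/(pi_elt_disjoint pf).
    by apply: sub_p_elt (p_elt_constt r g) => s; rewrite !inE => /eqP->.
  by rewrite groupX.
by apply: contra nfg; apply: mem_cycle_constt.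
Qed.
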